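(* Let $v\in\mathbb{N}\setminus\{1\}$ and let $h\colon\mathbb{N}_2\to\mathbb{C}$ be a $v$-transitive light weight such that $v\in V(h)$. Suppose that $D_h(1)_1$, $C_{h,v}(1)_1$, $C_h(1)_1$, $B_{h,v}(1)_1$, $B_h(1)_1$ and $A_{h,v}(1)_1$ exist. Then $B_h(1)_1\ne0$ and $$A_{h,v}(1)_1\in D_h(1)_1\cdot\mathrm{sqrt}\Big(1-\frac{B_{h,v}(1)_1}{B_h(1)_1}\Big).$$
   Context: $\mathbb{N}=\{1,2,\dots\}$, $\mathbb{N}_0=\{0,1,2,\dots\}$, and $\mathbb{N}_2=\{e\subset\mathbb{N}:|e|=2\}$. A weight is a map $h\colon\mathbb{N}_2\to\mathbb{C}$. A walk of length $n\in\mathbb{N}_0$ is a tuple $w=\langle v_0,\dots,v_n\rangle$ of elements of $\mathbb{N}$ with $v_{i-1}\ne v_i$ for $i=1,\dots,n$; its weight is $h(w)=\prod_{i=1}^n h(\{v_{i-1},v_i\})$ (and $h(w)=1$ if $n=0$). A series $\sum_{x\in X}g(x)$ over an at most countable set $X$ converges absolutely if the sums $\sum_{x\in Y}|g(x)|$ over finite $Y\subset X$ are bounded. For a set $W$ of walks, $h(W)$ denotes the sum of $\sum_{w\in W}h(w)$ when it converges absolutely. $W(n)$ is the set of walks of length $n$ with $v_0=1$. The weight $h$ is light if $\sum_{w\in W(n)}h(w)$ converges absolutely for every $n\in\mathbb{N}_0$. $V(h)$ is the set of vertices $u\in\mathbb{N}$ such that some walk starting at $1$ and ending at $u$ has nonzero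 weight. For $v\in\mathbb{N}\setminus\{1\}$, $h$ is $v$-transitive if there is a bijection $f\colon\mathbb{N}\to\mathbb{N}$ with $f(1)=v$ and $h(\{f(a),f(b)\})=h(\{a,b\})$ for all $\{a,b\}\in\mathbb{N}_2$. Define formal power series in $\mathbb{C}[[x]]$ (coefficient of $x^n$ given): $A_{h,v}$: $h(W(v,n))$, where $W(v,n)$ is the set of walks in $W(n)$ visiting $v$; $B_h$: $b_n^h=h(W_b(n))$, $W_b(n)$ = walks of length $n$ with $v_0=v_n=1$; $B_{h,v}$: $b_n^{h,v}$ = weight of the walks of length $n$ with $v_0=v_n=1$ and $v_i\ne v$ for all $i$; $C_h$: $c_n^h$ = weight of walks of length $n\ge1$ with $v_0=v_n=1$ and $v_i\ne1$ for $0<i<n$ ($c_0^h=0$); $C_{h,v}$: weight of walks of length $n$ with $v_0=1$, $v_n=v$, $v_i\ne v$ for $i<n$; $D_h$: $h(W(n))$. For $U(x)=\sum_{n\ge0}u_nx^n\in\mathbb{C}[[x]]$, we say $U(1)_1$ exists if $\lim_{n\to\infty}\sum_{j=0}^nu_j$ exists in $\mathbb{C}$, and $U(1)_1$ denotes this limit. For $w,z\in\mathbb{C}$, $w\cdot\mathrm{sqrt}(z)=\{w\alpha:\alpha\in\mathbb{C},\ \alpha^2=z\}$, and $\mathrm{sqrt}(z)=1\cdot\mathrm{sqrt}(z)$. *)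

(* Defs.v *)
From HB Require Import structures.
From mathcomp Require Export all_boot all_order all_algebra finmap complex.
From mathcomp Require Export all_classical all_reals all_analysis.
From mathcomp.analysis.showcase Require summability.
Export numFieldNormedType.Exports.

Set Implicit Arguments.
Unset Strict Implicit.
Unset Printing Implicit Defensive.
Import Order.TTheory GRing.Theory Num.Theory.
Local Open Scope classical_set_scope.
Local Open Scope ring_scope.
Local Open Scope complex_scope.

(* R[i] carries no topology of its own; packed as a numClosedFieldType it gets
   the one induced by its norm. *)
Definition cplx (R : realType) : numClosedFieldType := R[i].

Notation vertex := {n : nat | (0 < n)%N}.

Definition one : vertex := exist _ 1%N isT.

Notation edge := {e : {fset vertex} | #|` e| == 2%N}.

Definition weight (R : realType) := edge -> cplx R.

Section Sums.
Context {R : realType} {T : choiceType}.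
Implicit Types (X : set T) (g : T -> cplx R).

Definition abs_summable X g :=
  exists M : R, forall Y : {fset T}, [set` Y] `<=` X ->
    \sum_(x <- Y) `|g x| <= (M%:C : cplx R).

(* The unordered sum over X, as a limit along the finite subsets of T directed
   by inclusion; meaningful when [abs_summable X g] holds. *)
Definition sum_over X g : cplx R := summability.sum (g \_ X).

End Sums.

Section Walks.

(* The i-th vertex of a walk; the default is never reached for i <= n. *)
Definition vtx (w : seq vertex) (i : nat) : vertex := nth one w i.

(* A walk of length n is a sequence of n.+1 vertices. *)
Definition is_walk (n : nat) (w : seq vertex) :=
  size w = n.+1 /\ forall i, (i < n)%N -> vtx w i <> vtx w i.+1.

Definition W (n : nat) : set (seq vertex) :=
  [set w | is_walk n w /\ vtx w 0 = one].

Definition W_visit (v : vertex) (n : nat) : set (seq vertex) :=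
  [set w | W n w /\ exists2 i, (i <= n)%N & vtx w i = v].

Definition W_b (n : nat) : set (seq vertex) :=
  [set w | W n w /\ vtx w n = one].

Definition W_b_avoid (v : vertex) (n : nat) : set (seq vertex) :=
  [set w | W_b n w /\ forall i, (i <= n)%N -> vtx w i <> v].

Definition W_c (n : nat) : set (seq vertex) :=
  [set w | [/\ (1 <= n)%N, W_b n w &
     forall i, (0 < i < n)%N -> vtx w i <> one]].

Definition W_c_to (v : vertex) (n : nat) : set (seq vertex) :=
  [set w | [/\ W n w, vtx w n = v &
     forall i, (i < n)%N -> vtx w i <> v]].

End Walks.

Section Weights.
Context {R : realType}.
Implicit Types (h : weight R) (v : vertex) (w : seq vertex).

(* h({a, b}); the value 0 at a = b is a dummy, never used on a walk. *)
Definition pair_weight h (a b : vertex) : cplx R :=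
  if insub [fset a; b]%fset is Some e then h e else 0.

Definition walk_weight h w : cplx R :=
  \prod_(i < (size w).-1) pair_weight h (vtx w i) (vtx w i.+1).

Definition set_weight h (X : set (seq vertex)) : cplx R :=
  sum_over X (walk_weight h).

Definition light h := forall n, abs_summable (W n) (walk_weight h).

Definition V h : set vertex :=
  [set u | exists n w, [/\ W n w, vtx w n = u & walk_weight h w <> 0]].

Definition transitive_at v h :=
  exists f : vertex -> vertex, [/\ bijective f, f one = v &
    forall a b, a != b -> pair_weight h (f a) (f b) = pair_weight h a b].

(* Formal power series are given by their coefficient sequences. *)
Definition A_ h v : nat -> cplx R := fun n => set_weight h (W_visit v n).
Definition B_ h : nat -> cplx R := fun n => set_weight h (W_b n).
Definition Bv_ h v : nat -> cplx R := fun n => set_weight h (W_b_avoid v n).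
Definition C_ h : nat -> cplx R := fun n => set_weight h (W_c n).
Definition Cv_ h v : nat -> cplx R := fun n => set_weight h (W_c_to v n).
Definition D_ h : nat -> cplx R := fun n => set_weight h (W n).

End Weights.

Section ValuesAtOne.
Context {R : realType}.
Implicit Types (U : nat -> cplx R) (w z : cplx R).

Definition exists_at1 U := cvgn (fun n => \sum_(j < n.+1) U j).

Definition at1 U : cplx R := limn (fun n => \sum_(j < n.+1) U j).

Definition mul_sqrt w z : set (cplx R) :=
  [set w * alpha | alpha in [set alpha : cplx R | alpha ^+ 2 = z]].

End ValuesAtOne.

(* Main.v *)
Require Import Defs.
From mathcomp Require Import ring lra.

(* Write [*] for the Cauchy product of coefficient sequences. Cutting a walk at
   its first visit to [v] gives A = Cv * D, since by transitivity the walks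
   starting at [v] have the same total weights as those starting at 1. Cutting
   a closed walk at its first return gives B = 1 + C * B. Cutting a closed walk
   at its first visit to [v] gives B - Bv = Cv * E, where E is for walks
   from [v] to 1; reversing them and cutting again at the first visit to [v]
   gives E = Cv * B.
   These identities pass to the values at 1: a Cauchy product of three
   convergent series is Cesaro summable of order 2 to the product of the sums,
   so if it converges, it converges to that product; no convergence of E is
   needed. Hence A(1) = Cv(1) D(1), B(1) (1 - C(1)) = 1 and
   B(1) - Bv(1) = Cv(1)^2 B(1), and the square root is Cv(1). *)

Set Implicit Arguments.
Unset Strict Implicit.
Unset Printing Implicit Defensive.
Import Order.TTheory GRing.Theory Num.Theory.
Local Open Scope classical_set_scope.
Local Open Scope ring_scope.
Local Open Scope complex_scope.

(** * Cauchy products and Cesaro means *)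

Section CauchyProduct.
Context {K : comNzRingType}.
Implicit Types a b c : nat -> K.

Definition conv a b : nat -> K :=
  fun n => \sum_(i < n.+1) a i * b (n - i)%N.

Definition ones : nat -> K := fun=> 1.

Definition delta : nat -> K := fun n => (n == 0%N)%:R.

(** The coefficients of (1 - x)^-(k+1), which normalise Cesaro means of order [k]. *)
Definition ones_pow k : nat -> K := iter k (conv ones) ones.

(** Coefficients below [N] do not see a truncation at [N], so the laws of [conv] can be inherited
    from the polynomial ring. *)
Lemma coef_conv N a b n : (n < N)%N ->
  conv a b n = ((\poly_(i < N) a i) * \poly_(i < N) b i)`_n.
Proof.
move=> nN; rewrite coefM; apply: eq_bigr => i _.
by rewrite !coef_poly (leq_ltn_trans (leq_ord i)) // (leq_ltn_trans (leq_subr _ _)).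
Qed.

Lemma convC a b : conv a b = conv b a.
Proof. by apply/funext => n; rewrite !(@coef_conv n.+1) // mulrC. Qed.

Lemma poly_conv N a b n : (n < N)%N ->
  (\poly_(i < N) conv a b i)`_n = ((\poly_(i < N) a i) * \poly_(i < N) b i)`_n.
Proof. by move=> nN; rewrite coef_poly nN (coef_conv _ _ nN). Qed.

Lemma convA a b c : conv a (conv b c) = conv (conv a b) c.
Proof.
apply/funext => n; rewrite !(@coef_conv n.+1) //.
transitivity ((\poly_(i < n.+1) a i * (\poly_(i < n.+1) b i * \poly_(i < n.+1) c i))`_n).
  rewrite !coefM; apply: eq_bigr => i _.
  by rewrite poly_conv // ltnS leq_subr.
rewrite mulrA !coefM; apply: eq_bigr => i _.
by rewrite poly_conv.
Qed.

Lemma conv_delta a : conv a delta = a.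
Proof.
apply/funext => n; rewrite /conv big_ord_recr /= subnn mulr1.
rewrite big1 ?add0r // => i _; rewrite /delta subn_eq0 leqNgt ltn_ord.
by rewrite mulr0.
Qed.

Lemma conv_ones a n : conv a ones n = \sum_(i < n.+1) a i.
Proof. by apply: eq_bigr => i _; rewrite mulr1. Qed.

Lemma ones_powS k : ones_pow k.+1 = conv ones (ones_pow k).
Proof. by []. Qed.

Lemma ones_pow1 n : ones_pow 1 n = n.+1%:R.
Proof. by rewrite /ones_pow/= conv_ones sumr_const card_ord. Qed.

(** Triangular numbers; the factor 2 avoids a division in [K]. *)
Lemma ones_pow2 n : 2 * ones_pow 2 n = (n.+1 * n.+2)%:R.
Proof.
have -> : ones_pow 2 n = \sum_(i < n.+1) ones_pow 1 i by rewrite -conv_ones convC.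
elim: n => [|n IHn]; first by rewrite big_ord1 (ones_pow1 0) mulr1 mul1n.
rewrite big_ord_recr mulrDr IHn (ones_pow1 n.+1) -natrM -natrD; congr _%:R.
by rewrite -mulnDl addn2 mulnC.
Qed.

End CauchyProduct.

(** * Growth rates and Cesaro summation of complex sequences *)

Section Cesaro.
Context {R : realType}.
Implicit Types (p t u : nat -> cplx R) (z : cplx R) (k : nat).

(** A modulus with values in [R]; the norm [|z|] lies in [cplx R], whose order is only partial. *)
Definition nrm z : R := ComplexField.Normc.normc z.

Lemma nrmE z : `|z| = (nrm z)%:C. Proof. by []. Qed.

Lemma nrm_ge0 z : 0 <= nrm z.
Proof. by rewrite -lecR -nrmE normr_ge0. Qed.

Lemma nrm0 : nrm 0 = 0.
Proof. exact: ComplexField.Normc.normc0. Qed.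

Lemma nrm1 : nrm 1 = 1.
Proof. exact: ComplexField.Normc.normc1. Qed.

Lemma nrmM z z' : nrm (z * z') = nrm z * nrm z'.
Proof. exact: ComplexField.Normc.normcM. Qed.

Lemma ler_nrmD z z' : nrm (z + z') <= nrm z + nrm z'.
Proof. exact: le_normcD. Qed.

Lemma nrm_sum (I : Type) (r : seq I) (F : I -> cplx R) :
  nrm (\sum_(i <- r) F i) <= \sum_(i <- r) nrm (F i).
Proof.
elim/big_ind2 : _ => [|x a y b xa yb|i _//]; first by rewrite nrm0.
exact: le_trans (ler_nrmD _ _) (lerD xa yb).
Qed.

Lemma nrm_natr n : nrm n%:R = n%:R.
Proof. by apply: complexI; rewrite -nrmE normr_nat rmorph_nat. Qed.

Lemma cvg_nrm u z : u @ \oo --> z <-> (fun n => nrm (u n - z)) @ \oo --> (0 : R).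
Proof.
split=> [/cvgrPdist_lt uz|uz].
  apply/cvgrPdist_lt => e e0.
  have /uz : (0 : cplx R) < e%:C by rewrite ltcR.
  apply: filterS => n; rewrite distrC nrmE ltcR sub0r normrN ger0_norm ?nrm_ge0//.
apply/cvgrPdist_lt => e e0.
(* A positive element for the order of [cplx R] is real, so real tolerances suffice. *)
have ee : e = (complex.Re e)%:C by rewrite RRe_real// gtr0_real.
have e0' : 0 < complex.Re e by rewrite -ltcR -ee.
move/cvgrPdist_lt : uz => /(_ _ e0'); apply: filterS => n.
by rewrite sub0r normrN ger0_norm ?nrm_ge0// ee distrC nrmE ltcR.
Qed.

(** Little o of n^k; the shift to [n.+1] keeps the quotient meaningful at 0. *)
Definition negligible k p := (fun n => nrm (p n) / n.+1%:R ^+ k) @ \oo --> (0 : R).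

Definition poly_bounded k p := exists M : R, forall n, nrm (p n) <= M * n.+1%:R ^+ k.

(** With e_i = |p_i| / (i+1)^j, each term of the convolution is at most e_i (n+1)^j M (n+1)^k. The
    sum is thus at most M (n+1)^(j+k+1) times the mean of e_0, ..., e_n, and the means of a null
    sequence tend to 0. *)
Lemma negligible_conv j k p t :
  negligible j p -> poly_bounded k t -> negligible (j + k).+1 (conv p t).
Proof.
move=> p0 [M tM].
have M0 : 0 <= M by have := tM 0%N; rewrite expr1n mulr1; apply: le_trans (nrm_ge0 _).
pose e n := nrm (p n) / n.+1%:R ^+ j.
have e_ge0 n : 0 <= e n by rewrite divr_ge0// ?nrm_ge0// exprn_ge0.
apply: (@squeeze_cvgr _ _ _ _ (fun=> 0) (fun n => M * arithmetic_mean e n)).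
- apply: nearW => n; rewrite divr_ge0 ?nrm_ge0 ?exprn_ge0//=.
  rewrite /arithmetic_mean /= seriesEord/= ler_pdivrMr ?exprn_gt0//.
  have -> : M * (n.+1%:R^-1 * \sum_(i < n.+1) e i) * n.+1%:R ^+ (j + k).+1 =
      \sum_(i < n.+1) e i * n.+1%:R ^+ j * (M * n.+1%:R ^+ k).
    rewrite -!mulr_suml exprS exprD.
    have : (n.+1%:R : R) != 0 by rewrite pnatr_eq0.
    by move: (n.+1%:R : R) => x x0; move: (\sum_(_ < _) _) => y; field.
  rewrite /conv (le_trans (nrm_sum _ _))// ler_sum// => i _.
  rewrite nrmM ler_pM ?nrm_ge0//.
    rewrite -ler_pdivrMr ?exprn_gt0// /e.
    rewrite ler_wpM2l ?nrm_ge0// lef_pV2 ?posrE ?exprn_gt0//.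
    by rewrite lerXn2r ?nnegrE// ler_nat.
  apply: le_trans (tM _) _; rewrite ler_wpM2l// lerXn2r ?nnegrE// ler_nat.
  by rewrite ltnS leq_subr.
- exact: cvg_cst.
- by rewrite -(mulr0 M); apply: cvgMl_tmp; apply: cesaro.
Qed.

Lemma negligible_poly_bounded k p : negligible k p -> poly_bounded k p.
Proof.
move=> p0; have /cvg_seq_bounded : cvgn (fun n => nrm (p n) / n.+1%:R ^+ k).
  exact: cvgP p0.
move=> /pinfty_ex_gt0[M _ pM]; exists M => n.
by rewrite -ler_pdivrMr ?exprn_gt0// (le_trans (ler_norm _)) ?pM.
Qed.

Lemma negligibleD k p t : negligible k p -> negligible k t ->
  negligible k (fun n => p n + t n).
Proof.
move=> p0 t0.
apply: (@squeeze_cvgr _ _ _ _ (fun=> 0)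
  (fun n => nrm (p n) / n.+1%:R ^+ k + nrm (t n) / n.+1%:R ^+ k)).
- apply: nearW => n; rewrite divr_ge0 ?nrm_ge0 ?exprn_ge0//=.
  by rewrite -mulrDl ler_wpM2r ?invr_ge0 ?exprn_ge0// ler_nrmD.
- exact: cvg_cst.
- by rewrite -(addr0 0); apply: cvgD.
Qed.

Lemma negligibleZ k z p : negligible k p -> negligible k (fun n => z * p n).
Proof.
rewrite /negligible => p0.
have -> : (fun n => nrm (z * p n) / n.+1%:R ^+ k) =
    (fun n => nrm z * (nrm (p n) / n.+1%:R ^+ k)).
  by apply/funext => n; rewrite nrmM mulrA.
by rewrite -[X in _ --> X](mulr0 (nrm z)); apply: cvgMl_tmp.
Qed.

Lemma poly_bounded_ones_pow k : poly_bounded k (ones_pow k).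
Proof.
exists 1 => n; rewrite mul1r; elim: k n => [|k IHk] n.
  by have -> : nrm (ones_pow 0 n) = 1 by exact: nrm1.
rewrite ones_powS convC conv_ones.
apply: (le_trans (nrm_sum _ _)).
have -> : (n.+1%:R : R) ^+ k.+1 = \sum_(i < n.+1) n.+1%:R ^+ k.
  by rewrite sumr_const card_ord exprS mulr_natl.
apply: ler_sum => i _; apply: le_trans (IHk _) _.
by rewrite lerXn2r ?nnegrE// ler_nat.
Qed.

(* [p] is asymptotically [z] times the coefficients of (1 - x)^-(k+1). *)
Definition cesaro_eq k p z := negligible k (fun n => p n - z * ones_pow k n).

(** Put p = z [ones_pow k] + e and t = z' [ones] + f. The error of the product is e * t + z (f *
    [ones_pow k]): a negligible factor against a bounded one, then a null sequence against one of
    order n^k. *)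
Lemma cesaro_eq_conv k p t z z' : cesaro_eq k p z -> cesaro_eq 0 t z' ->
  cesaro_eq k.+1 (conv p t) (z * z').
Proof.
move=> pz tz.
pose e n := p n - z * ones_pow k n; pose f n := t n - z' * ones n.
have tb : poly_bounded 0 t.
  have [M fM] := negligible_poly_bounded tz; exists (M + nrm z') => n.
  rewrite -[t n](subrK (z' * ones_pow 0 n)) (le_trans (ler_nrmD _ _))//.
  rewrite mulrDl lerD//= nrmM nrm1 expr0 !mulr1 //.
rewrite /cesaro_eq.
have -> : (fun n => conv p t n - z * z' * ones_pow k.+1 n) =
   (fun n => conv e t n + z * conv f (ones_pow k) n).
  rewrite ones_powS [conv ones _]convC [conv f _]convC; apply/funext => n.
  rewrite /conv !mulr_sumr -sumrB -big_split; apply: eq_bigr => i _.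
  by rewrite /e /f /=; ring.
apply: negligibleD.
  by have := negligible_conv pz tb; rewrite addn0.
by apply: negligibleZ; apply: (@negligible_conv 0 k) => //; exact: poly_bounded_ones_pow.
Qed.

(** The difference z' - z times [ones_pow 2] is o(n^2), whereas [ones_pow 2] itself grows like n^2 /
    2. *)
Lemma cesaro_eq2_unique p z z' : cesaro_eq 2 p z -> cesaro_eq 2 p z' -> z = z'.
Proof.
move=> pz pz'.
have := negligibleD (negligibleZ (-1) pz) pz'.
under [X in negligible _ X]eq_fun => n do
  rewrite mulN1r opprB addrA subrK -mulrBl.
move=> /cvgr0Pnorm_lt zz'; apply/eqP; rewrite -subr_eq0; apply/eqP.
apply: ComplexField.Normc.eq0_normc; rewrite -/(nrm _).
apply/eqP; rewrite eq_le nrm_ge0 andbT; apply/ler_addgt0Pl => e e0.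
(* The tolerance is e / 2 because [ones_pow 2 n] is at least (n+1)^2 / 2. *)
have [n _ /(_ n (leqnn n))] := zz' _ (divr_gt0 e0 (ltr0Sn _ 1)).
rewrite ger0_norm ?divr_ge0 ?nrm_ge0 ?exprn_ge0// nrmM => H.
rewrite addr0; move: H.
have : 2 * nrm (ones_pow 2 n) = n.+1%:R * n.+2%:R.
  by rewrite -[2]nrm_natr -nrmM ones_pow2 nrm_natr natrM.
rewrite ltr_pdivrMr ?exprn_gt0//.
move: (nrm (ones_pow 2 n)) => a; rewrite -[n.+2]addn1 natrD => aE.
have : 1 <= (n.+1%:R : R) by rewrite (ler_nat _ 1).
have := nrm_ge0 (z' - z); move: aE; move: (n.+1%:R : R) => x.
nra.
Qed.

Definition psum u : nat -> cplx R := fun n => \sum_(j < n.+1) u j.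

Lemma psumE u : psum u = conv u ones.
Proof. by apply/funext => n; rewrite conv_ones. Qed.

Lemma cesaro_eq_psum u z : psum u @ \oo --> z -> cesaro_eq 0 (psum u) z.
Proof.
move=> /cvg_nrm uz; rewrite /cesaro_eq /negligible.
by under eq_cvg do rewrite expr0 divr1 /ones_pow/= /ones mulr1.
Qed.

(** Taking partial sums is convolving with [ones]. Hence the product of the three sequences of
    partial sums is the partial sums of the product convolved twice more with [ones]; its Cesaro
    value of order 2 is z0 z1 z2 by the first form and z by the second. *)
Lemma psum_conv3 u0 u1 u2 z z0 z1 z2 :
  psum (conv u0 (conv u1 u2)) @ \oo --> z ->
  psum u0 @ \oo --> z0 -> psum u1 @ \oo --> z1 -> psum u2 @ \oo --> z2 ->
  z = z0 * z1 * z2.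
Proof.
move=> /cesaro_eq_psum uz /cesaro_eq_psum uz0 /cesaro_eq_psum uz1 /cesaro_eq_psum uz2.
apply: (@cesaro_eq2_unique (conv (conv (psum u0) (psum u1)) (psum u2))); last first.
  by apply: cesaro_eq_conv => //; apply: cesaro_eq_conv.
have -> : conv (conv (psum u0) (psum u1)) (psum u2) =
    conv (conv (psum (conv u0 (conv u1 u2))) ones) ones.
  rewrite !psumE -!convA; congr (conv u0 _); rewrite (convA ones u1) (convC ones u1).
  by rewrite -!convA; congr (conv u1 _); rewrite (convC u2 ones) [RHS]convC -!convA.
have ones1 : cesaro_eq 0 ones 1.
  rewrite /cesaro_eq /negligible (_ : (fun n => _) = fun=> 0); first exact: cvg_cst.
  apply/funext => n; have -> : ones n - 1 * ones_pow 0 n = 0 :> cplx R.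
    by rewrite mul1r; exact: subrr.
  by rewrite nrm0 mul0r.
rewrite -[z]mulr1 -[z * 1]mulr1.
by apply: cesaro_eq_conv => //; apply: cesaro_eq_conv.
Qed.

Lemma cvg_psum u : exists_at1 u -> psum u @ \oo --> at1 u.
Proof. by []. Qed.

Lemma psum_delta : psum delta @ \oo --> (1 : cplx R).
Proof.
rewrite (_ : psum _ = fun=> 1); first exact: cvg_cst.
by apply/funext => n; rewrite /psum big_ord_recl big1 ?addr0.
Qed.

Lemma psum_conv u0 u1 z z0 z1 : psum (conv u0 u1) @ \oo --> z ->
  psum u0 @ \oo --> z0 -> psum u1 @ \oo --> z1 -> z = z0 * z1.
Proof.
move=> uz uz0 uz1.
(* The third factor is [delta], the unit of [conv], whose partial sums are constantly 1. *)
have -> : z = z0 * z1 * 1 by apply: psum_conv3 uz0 uz1 psum_delta; rewrite conv_delta.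
by rewrite mulr1.
Qed.

End Cesaro.

(** * Unordered sums *)

#[local] Existing Instance summability.totally_filter.

Section UnorderedSums.
Context {R : realType}.
Local Open Scope fset_scope.
Local Open Scope ring_scope.
Implicit Types T : choiceType.

Definition has_sum T (x : T -> cplx R) (l : cplx R) :=
  summability.partial_sum x @ summability.totally --> l.

Lemma has_sumE T (x : T -> cplx R) l : has_sum x l -> summability.sum x = l.
Proof. exact: (@cvg_lim _ (@norm_hausdorff (cplx R) (cplx R))). Qed.

Lemma has_sumP T (x : T -> cplx R) l : has_sum x l <->
  forall e : R, 0 < e -> exists F0 : {fset T}, forall F : {fset T}, F0 `<=` F ->
    nrm (l - \sum_(i <- F) x i) < e.
Proof.
split=> [/cvgrPdist_lt xl e e0|xl].
  have /xl[F0 _ F0P] : (0 : cplx R) < e%:C by rewrite ltcR.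
  exists F0 => F /F0P; rewrite /= /summability.partial_sum.
  by rewrite big_seq_fsetE nrmE ltcR.
apply/cvgrPdist_lt => e e0.
have ee : e = (complex.Re e)%:C by rewrite RRe_real// gtr0_real.
have e0' : 0 < complex.Re e by rewrite -ltcR -ee.
have [F0 F0P] := xl _ e0'; exists F0 => // F /F0P.
by rewrite /= /summability.partial_sum big_seq_fsetE ee nrmE ltcR.
Qed.

Lemma has_sumD T (x y : T -> cplx R) l m : has_sum x l -> has_sum y m ->
  has_sum (fun i => x i + y i) (l + m).
Proof.
move=> xl ym; rewrite /has_sum.
suff -> : summability.partial_sum (fun i => x i + y i) =
  fun F => summability.partial_sum x F + summability.partial_sum y F by exact: (cvgD xl ym).
by apply/funext => F; rewrite -big_split.
Qed.

Lemma has_sumZ T (x : T -> cplx R) c l : has_sum x l ->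
  has_sum (fun i => c * x i) (c * l).
Proof.
move=> xl; rewrite /has_sum.
suff -> : summability.partial_sum (fun i => c * x i) =
  fun F => c * summability.partial_sum x F by exact: cvgMl_tmp.
by apply/funext => F; rewrite /summability.partial_sum mulr_sumr.
Qed.

Lemma ler_sum_fsubset (K : numDomainType) T (A B : {fset T}) (f : T -> K) :
  A `<=` B -> (forall i, 0 <= f i) -> \sum_(i <- A) f i <= \sum_(i <- B) f i.
Proof.
move=> AB f0; rewrite [leRHS](big_fsetID _ (mem A)) /=.
rewrite -[leLHS]addr0 lerD ?sumr_ge0//.
rewrite le_eqVlt; apply/orP; left; apply/eqP; apply: eq_fbigl => i.
by rewrite !inE andb_idl// => /(fsubsetP AB).
Qed.

Lemma nrm_real (a : R) : nrm a%:C = `|a|.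
Proof. by rewrite /nrm /= expr0n/= addr0 sqrtr_sqr. Qed.

(** Finite sums of nonnegative terms increase with the index set, so they converge to their
    supremum. *)
Lemma has_sum_ge0 T (x : T -> R) (M : R) : (forall i, 0 <= x i) ->
  (forall F : {fset T}, \sum_(i <- F) x i <= M) ->
  exists l, has_sum (fun i => (x i)%:C : cplx R) l.
Proof.
move=> x0 xM; pose S := [set \sum_(i <- F) x i | F in [set: {fset T}]]%classic.
have Sub : has_ubound S by exists M => _ [F _ <-].
have Ssup : has_sup S by split=> //; exists (\sum_(i <- fset0) x i), fset0.
exists (sup S)%:C; apply/has_sumP => e e0.
have [_ [F0 _ <-] F0P] := sup_adherent e0 Ssup; exists F0 => F F0F.
rewrite -rmorph_sum -rmorphB nrm_real ger0_norm; last first.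
  by rewrite subr_ge0; apply: ub_le_sup => //; exists F.
by rewrite ltrBlDl -ltrBlDr (lt_le_trans F0P)// ler_sum_fsubset.
Qed.

(** Write x = (|x| + x) - |x|, a difference of two nonnegative families with bounded finite sums. *)
Lemma has_sum_real T (x : T -> R) (M : R) :
  (forall F : {fset T}, \sum_(i <- F) `|x i| <= M) ->
  exists l, has_sum (fun i => (x i)%:C : cplx R) l.
Proof.
move=> xM.
have [i|F|l xl] := @has_sum_ge0 T (fun i => `|x i| + x i) (M + M).
- by rewrite -lerBlDl sub0r lerNnormlW.
- rewrite big_split lerD// (le_trans _ (xM F))// ler_sum// => i _.
  exact: ler_norm.
have [i|//|m xm] := @has_sum_ge0 T (fun i => `|x i|) M; first exact: normr_ge0.
exists (l + (-1) * m); have := has_sumD xl (@has_sumZ _ _ (-1) _ xm).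
congr has_sum; apply/funext => i.
by rewrite rmorphD mulN1r addrAC subrr add0r.
Qed.

(** The real and imaginary parts are dominated by the modulus and are summed separately. *)
Lemma has_sum_abs T (x : T -> cplx R) (M : R) :
  (forall F : {fset T}, \sum_(i <- F) nrm (x i) <= M) -> exists l, has_sum x l.
Proof.
move=> xM.
have Re_le (z : R[i]) : `|complex.Re z| <= nrm z.
  by rewrite -lecR -nrmE; exact: normc_ge_Re.
have Im_le (z : R[i]) : `|complex.Im z| <= nrm z.
  (* Up to sign, the imaginary part of z is the real part of iz, which has the same modulus. *)
  rewrite -normrN -ReiNIm (le_trans (Re_le _))// nrmM.
  by rewrite /nrm /= expr0n/= expr1n add0r sqrtr1 mulr1.
have [F|l xl] := @has_sum_real T (fun i => complex.Re (x i)) M.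
  by rewrite (le_trans _ (xM F))// ler_sum.
have [F|m xm] := @has_sum_real T (fun i => complex.Im (x i)) M.
  by rewrite (le_trans _ (xM F))// ler_sum.
exists (l + 'i%C * m); have := has_sumD xl (@has_sumZ _ _ 'i%C _ xm).
by congr has_sum; apply/funext => i; rewrite -complexE.
Qed.

(** * Sums over subsets and their additivity *)

Section SumOver.
Context {T : choiceType}.
Implicit Types (X Y : set T) (g : T -> cplx R).

Lemma abs_summableP X g : abs_summable X g <-> exists M : R,
  forall F : {fset T}, (forall i, i \in F -> X i) -> \sum_(i <- F) nrm (g i) <= M.
Proof.
by split=> -[M gM]; exists M => F FX; have := gM F FX; rewrite -rmorph_sum lecR.
Qed.

Lemma abs_summable_sub X Y g : (Y `<=` X)%classic ->
  abs_summable X g -> abs_summable Y g.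
Proof.
by move=> YX [M gM]; exists M => F FY; apply: gM => i /FY/YX.
Qed.

(** Guarantees that [sum_over] is a true limit and not a default value. *)
Lemma has_sum_sum_over X g : abs_summable X g ->
  has_sum (g \_ X)%classic (sum_over X g).
Proof.
move=> /abs_summableP[M gM].
have [F|l gl] := @has_sum_abs T (g \_ X)%classic M; last first.
  by rewrite /sum_over (has_sumE gl).
(* The bound concerns finite subsets of [X] only, so [F] is first cut down to [X]; the terms outside
   vanish. *)
have := gM [fset i in F | i \in X]; rewrite big_fset /= big_mkcond/=.
have H i : (i \in [fset i in F | i \in X]) -> X i.
  by rewrite !inE/= => /andP[_]; rewrite inE.
move=> /(_ H); apply: le_trans; rewrite ler_sum// => i _.
by rewrite /patch; case: ifPn => // _; rewrite [nrm _]nrm0.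
Qed.

Lemma sum_overU X Y g : (forall i, X i -> Y i -> False) ->
  abs_summable (X `|` Y)%classic g ->
  sum_over (X `|` Y)%classic g = sum_over X g + sum_over Y g.
Proof.
move=> XY gs; have gX : abs_summable X g by apply: abs_summable_sub gs => i; left.
have gY : abs_summable Y g by apply: abs_summable_sub gs => i; right.
apply: has_sumE.
have := has_sumD (has_sum_sum_over gX) (has_sum_sum_over gY).
congr has_sum; apply/funext => i; rewrite !patchE in_setU.
case: (boolP (i \in X)) => iX; case: (boolP (i \in Y)) => iY //=.
- by rewrite !inE in iX iY; case: (XY i).
- by rewrite [_ + _]addr0.
- by rewrite [_ + _]add0r.
- by rewrite [_ + _]addr0.
Qed.

Lemma eq_sum_over X Y g : (forall i, X i <-> Y i) -> sum_over X g = sum_over Y g.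
Proof. by move=> XY; congr sum_over; apply/seteqP; split=> i /XY. Qed.

Lemma sum_over_bigcup n (X : nat -> set T) g :
  (forall i j k, X j i -> X k i -> j = k) ->
  abs_summable [set i | exists2 k, (k < n)%N & X k i]%classic g ->
  sum_over [set i | exists2 k, (k < n)%N & X k i]%classic g =
  \sum_(k < n) sum_over (X k) g.
Proof.
move=> Xdisj; elim: n => [|n IHn] gs.
  rewrite big_ord0; apply: has_sumE; apply/has_sumP => e e0.
  exists fset0 => F _; rewrite big1 ?subrr ?nrm0// => i _.
  by rewrite patchE memNset// => -[].
rewrite big_ord_recr/= -IHn; last first.
  by apply: abs_summable_sub gs => i [k kn]; exists k => //; exact: leqW.
rewrite -sum_overU.
- apply: eq_sum_over => i; split=> [[k]|[[k kn]|]].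
  + by rewrite ltnS leq_eqVlt => /predU1P[->|kn ?]; [right|left; exists k].
  + by exists k => //; exact: leqW.
  + by exists n.
- by move=> i [k kn /Xdisj Xk] /Xk E; rewrite E ltnn in kn.
apply: abs_summable_sub gs => i [[k kn ?]|?]; last by exists n.
by exists k => //; exact: leqW.
Qed.

Lemma sum_over_set0 g : sum_over set0 g = 0.
Proof.
apply: has_sumE; apply/has_sumP => e e0; exists fset0 => F _.
by rewrite big1 ?subrr ?nrm0// => i _; rewrite /patch memNset.
Qed.

Lemma sum_over_set1 g i :
  sum_over [set i]%classic g = g i.
Proof.
apply: has_sumE; apply/has_sumP => e e0; exists [fset i]%fset => F iF.
rewrite -(big_fset_incl _ iF) => [|j _]; last first.
  by rewrite inE => ji; rewrite /patch memNset//= => E; rewrite E eqxx in ji.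
by rewrite big_seq_fset1 /patch mem_set// subrr nrm0.
Qed.

End SumOver.

(** * Change of index set along a bijection *)

Section Reindex.
Context {T T' : choiceType} (X : set T) (X' : set T').
Context (g : T -> cplx R) (g' : T' -> cplx R) (phi : T -> T') (psi : T' -> T).
Hypothesis phiX : forall i, X i -> X' (phi i).
Hypothesis psiX : forall j, X' j -> X (psi j).
Hypothesis phiK : forall i, X i -> psi (phi i) = i.
Hypothesis psiK : forall j, X' j -> phi (psi j) = j.
Hypothesis gphi : forall i, X i -> g' (phi i) = g i.

Let sum_psi (V : nmodType) (h : cplx R -> V) (F : {fset T'}) :
  (forall j, j \in F -> X' j) ->
  \sum_(j <- F) h (g' j) = \sum_(i <- psi @` F) h (g i).
Proof.
move=> FX'; rewrite big_imfset => [|i j iF jF /(congr1 phi)] /=.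
  apply: eq_fbigr => j jF _.
  by rewrite -gphi ?psiK//; [exact: FX'|exact/psiX/FX'].
by rewrite !psiK//; exact: FX'.
Qed.

Lemma abs_summable_reindex : abs_summable X g -> abs_summable X' g'.
Proof.
move=> /abs_summableP[M gM]; apply/abs_summableP; exists M => F FX'.
rewrite (sum_psi (@nrm R)) // gM// => i /imfsetP[j /= jF ->].
by apply: psiX; exact: FX'.
Qed.

Lemma sum_over_reindex : abs_summable X g -> sum_over X g = sum_over X' g'.
Proof.
move=> /has_sum_sum_over/has_sumP gs; apply/esym/has_sumE/has_sumP => e e0.
have [F0 F0P] := gs _ e0; exists (phi @` [fset i in F0 | i \in X]) => F' FF'.
pose F := [fset j in F' | j \in X'].
have FX' j : j \in F -> X' j by rewrite !inE/= => /andP[_]; rewrite inE.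
have -> : \sum_(j <- F') (g' \_ X')%classic j = \sum_(i <- psi @` F) g i.
  rewrite -(sum_psi id)//= big_fset /=.
  by rewrite [RHS]big_mkcond; apply: eq_bigr => j _; rewrite /patch.
(* Adjoining [F0] changes nothing: a point of [F0] in [X] is already in the image of [psi], since
   [F'] contains its image under [phi], and a point outside [X] contributes 0. *)
have -> : \sum_(i <- psi @` F) g i = \sum_(i <- psi @` F `|` F0) (g \_ X)%classic i.
  rewrite -[RHS](big_fset_incl _ (A := psi @` F)) ?fsubsetUl//.
    apply: eq_fbigr => i /imfsetP[j /= jF ->] _; rewrite /patch mem_set//.
    by apply: psiX; exact: FX'.
  move=> i; rewrite inE => /orP[->//|iF0] iF; rewrite /patch ifN//.
  apply: contra iF => iX; apply/imfsetP; exists (phi i) => /=; last first.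
    by rewrite phiK//; rewrite inE in iX.
  rewrite !inE/=; apply/andP; split; last by rewrite inE; apply/phiX/set_mem.
  by apply/(fsubsetP FF')/imfsetP; exists i => //; rewrite !inE/= iF0.
by apply: F0P; exact: fsubsetUr.
Qed.

End Reindex.

(** * Products of absolutely summable families *)

Section Product.
Context {T T' : choiceType} (X : set T) (Y : set T').
Context (f : T -> cplx R) (g : T' -> cplx R).
Hypotheses (fs : abs_summable X f) (gs : abs_summable Y g).

Let sum_fsetM (K : pzSemiRingType) (A : {fset T}) (B : {fset T'})
    (u : T -> K) (v : T' -> K) :
  \sum_(p <- A `*` B) u p.1 * v p.2 =
  (\sum_(i <- A) u i) * (\sum_(j <- B) v j).
Proof.
rewrite big_distrlr/= (pair_big_dep_cond _ _ (fun=> B)).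
apply: eq_fbigl => -[i j]; rewrite in_fsetM /=; apply/andP/imfset2P.
  by move=> [iA jB]; exists i; rewrite ?inE/= ?iA//; exists j; rewrite ?inE/= ?jB.
by move=> [i' /=]; rewrite !inE/= andbT => iA [j' /=]; rewrite !inE/= andbT => jB [-> ->].
Qed.

Lemma abs_summable_prod :
  abs_summable (X `*` Y)%classic (fun p => f p.1 * g p.2).
Proof.
have /abs_summableP[M fM] := fs; have /abs_summableP[N gN] := gs.
apply/abs_summableP; exists (M * N) => F FXY.
(* A finite set of pairs lies in the rectangle spanned by its two projections. *)
apply: (@le_trans _ _ (\sum_(p <- (fst @` F) `*` (snd @` F)) nrm (f p.1) * nrm (g p.2))).
  under eq_bigr do rewrite nrmM.
  apply: ler_sum_fsubset => [|p]; last by rewrite mulr_ge0 ?nrm_ge0.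
  apply/fsubsetP => -[i j] ijF; rewrite in_fsetM; apply/andP.
  by split; apply/imfsetP; exists (i, j).
rewrite (sum_fsetM _ _ (fun i => nrm (f i)) (fun j => nrm (g j))).
apply: ler_pM.
- by rewrite sumr_ge0// => i _; exact: nrm_ge0.
- by rewrite sumr_ge0// => i _; exact: nrm_ge0.
- by apply: fM => i /imfsetP[p /= /FXY[? _] ->].
- by apply: gN => i /imfsetP[p /= /FXY[_ ?] ->].
Qed.

Lemma sum_over_prod :
  sum_over (X `*` Y)%classic (fun p => f p.1 * g p.2) = sum_over X f * sum_over Y g.
Proof.
have /has_sum_sum_over/has_sumP := abs_summable_prod.
have /has_sum_sum_over/has_sumP := fs; have /has_sum_sum_over/has_sumP := gs.
move: (sum_over X f) (sum_over Y g) (sum_over (X `*` Y)%classic _) => l m fg gm fl fgP.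
apply/esym/eqP; rewrite -subr_eq0; apply/eqP; apply: ComplexField.Normc.eq0_normc.
rewrite -/(nrm _); apply/eqP; rewrite eq_le nrm_ge0 andbT.
apply/ler_addgt0Pl => e e0; rewrite addr0.
pose K := nrm l + nrm m + 1.
have K0 : 0 < K by rewrite ltr_wpDl ?addr_ge0 ?nrm_ge0.
(* For rectangle sums a and b within d of l and m, |lm - ab| is at most d|m| + |a|d. The bound d <=
   1 gives |a| <= |l| + 1, so the total is at most dK <= e / 2. *)
pose d := Num.min 1 (e / (2 * K)).
have d0 : 0 < d by rewrite lt_min ltr01 divr_gt0// mulr_gt0.
have [A AP] := fl _ d0; have [B BP] := gm _ d0.
have e20 : 0 < e / 2 by rewrite divr_gt0.
have [P PP] := fgP _ e20.
(* Enlarged by the projections of [P], the rectangle approximates all three sums at once. *)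
pose A' := A `|` fst @` P; pose B' := B `|` snd @` P.
have := AP A' (fsubsetUl _ _); have := BP B' (fsubsetUl _ _).
have : P `<=` A' `*` B'.
  apply/fsubsetP => -[i j] ijP; rewrite in_fsetM !inE; apply/andP.
  by split; apply/orP; right; apply/imfsetP; exists (i, j).
move=> /PP.
have -> : \sum_(p <- A' `*` B') ((fun p => f p.1 * g p.2) \_ (X `*` Y)%classic)%classic p =
   (\sum_(i <- A') (f \_ X)%classic i) * (\sum_(j <- B') (g \_ Y)%classic j).
  rewrite -sum_fsetM; apply: eq_bigr => -[i j] _ /=; rewrite /patch /=.
  rewrite in_setX /=; case: (i \in X); case: (j \in Y) => //=.
  - by rewrite [_ * _]mulr0.
  - by rewrite [_ * _]mul0r.
  - by rewrite [_ * _]mul0r.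
move: (\sum_(i <- A') _) (\sum_(j <- B') _) => a b abe bd ad.
have -> : l * m - fg = ((l - a) * m + (l - (l - a)) * (m - b)) + - (fg - a * b) by ring.
have nrmN z : nrm (- z) = nrm z by apply: complexI; rewrite -!nrmE normrN.
rewrite (le_trans (ler_nrmD _ _))// nrmN [leRHS]splitr lerD ?(ltW abe)//.
apply: (@le_trans _ _ (d * K)); last first.
  rewrite -ler_pdivlMr// -mulrA -invfM [2 * K]mulrC -/d.
  by rewrite ge_min [K * 2]mulrC lexx orbT.
rewrite (le_trans (ler_nrmD _ _))// !nrmM.
have la : nrm (l - (l - a)) <= nrm l + 1.
  rewrite (le_trans (ler_nrmD _ _))// nrmN lerD2l (le_trans (ltW ad))//.
  by rewrite ge_min lexx.
have -> : d * K = d * nrm m + (nrm l + 1) * d by rewrite /K; ring.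
apply: lerD; first by rewrite ler_wpM2r ?nrm_ge0// ltW.
by apply: ler_pM; rewrite ?nrm_ge0// ltW.
Qed.

End Product.

End UnorderedSums.

(** * Walks *)

#[local] Arguments vtx : simpl never.

Section Walks.
Context {R : realType}.
Implicit Types (h : weight R) (w p q : seq vertex) (a b c : vertex) (B : set vertex).

(** The endpoint ranges over a set so that free walks and walks with a prescribed end share one
    cutting argument. *)
Definition walks a B n : set (seq vertex) :=
  [set w | [/\ is_walk n w, vtx w 0 = a & B (vtx w n)]].

(* Walks of length [k] from the vertex 1 that reach [c] at time [k], for the
   first time since time [s]; only [s = 0] and [s = 1] are needed. *)
Definition first_hit s c k : set (seq vertex) :=
  [set w | [/\ W k w, (s <= k)%N, vtx w k = c &
    forall i, (s <= i < k)%N -> vtx w i <> c]].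

(** Taking [s = 1] discounts the visit at time 0, as is required for returns to the starting
    vertex. *)
Definition hitting s c B n : set (seq vertex) :=
  [set w | [/\ W n w, B (vtx w n) & exists2 i, (s <= i <= n)%N & vtx w i = c]].

Lemma pair_weightC h a b : pair_weight h a b = pair_weight h b a.
Proof. by rewrite /pair_weight fsetUC. Qed.

Lemma walk_weightE h w : walk_weight h w =
  \prod_(0 <= i < (size w).-1) pair_weight h (vtx w i) (vtx w i.+1).
Proof. by rewrite big_mkord. Qed.

Lemma vtx_map (f : vertex -> vertex) w i : (i < size w)%N ->
  vtx (map f w) i = f (vtx w i).
Proof. by move=> iw; rewrite /vtx (nth_map one). Qed.

Lemma vtx_take w k i : (i <= k)%N -> vtx (take k.+1 w) i = vtx w i.
Proof. by move=> ik; rewrite /vtx nth_take. Qed.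

Lemma vtx_drop w k i : vtx (drop k w) i = vtx w (k + i).
Proof. by rewrite /vtx nth_drop. Qed.

(** The two pieces share the vertex at time [k], so each edge falls in exactly one of them. *)
Lemma walk_weight_split h w n k : size w = n.+1 -> (k <= n)%N ->
  walk_weight h w = walk_weight h (take k.+1 w) * walk_weight h (drop k w).
Proof.
move=> wn kn; rewrite !walk_weightE size_takel ?wn// size_drop wn subSn//=.
rewrite (big_cat_nat (n := k))//=; congr (_ * _).
  by apply: eq_big_nat => i /andP[_ ik]; rewrite !vtx_take ?(ltnW ik).
rewrite -{1}[k]add0n big_addn; apply: eq_bigr => i _.
by rewrite !vtx_drop addnC addnS.
Qed.

Lemma is_walk_split w n k : size w = n.+1 -> (k <= n)%N ->
  is_walk n w <-> is_walk k (take k.+1 w) /\ is_walk (n - k) (drop k w).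
Proof.
move=> wn kn; rewrite /is_walk size_takel ?wn// size_drop wn subSn//.
split=> [[_ wP]|[[_ wP] [_ wQ]]].
  split; split=> // i ik.
    by rewrite !vtx_take ?(ltnW ik)//; apply: wP; apply: leq_trans kn.
  by rewrite !vtx_drop addnS; apply: wP; rewrite -ltn_subRL.
split=> // i ilt; have [ik|ki] := ltnP i k.
  by have := wP i ik; rewrite !vtx_take ?(ltnW ik).
have := wQ (i - k)%N; rewrite !vtx_drop addnS subnKC//; apply.
by rewrite ltn_sub2r// (leq_ltn_trans ki).
Qed.

Lemma take_drop_glue p q k m c : size p = k.+1 -> size q = m.+1 ->
  vtx p k = c -> vtx q 0 = c ->
  take k.+1 (p ++ behead q) = p /\ drop k (p ++ behead q) = q.
Proof.
move=> pk; case: q => // q0 q [qm] pc /= q0c; split; first by rewrite take_size_cat.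
rewrite drop_cat pk leqnn (drop_nth one) ?pk// drop_oversize ?pk//.
by rewrite -[nth one p k]/(vtx p k) pc -q0c.
Qed.

Lemma glue_take_drop w k : take k.+1 w ++ behead (drop k w) = w.
Proof. by rewrite -drop1 drop_drop add1n cat_take_drop. Qed.

(** Cutting at time [k] is a bijection onto pairs of pieces meeting at [c]; its inverse drops the
    repeated [c] by [behead]. As the weight is multiplicative, the sum factors. *)
Lemma sum_over_glue h n k (P Q : set (seq vertex)) c : (k <= n)%N ->
  (forall p, P p -> size p = k.+1 /\ vtx p k = c) ->
  (forall q, Q q -> size q = (n - k).+1 /\ vtx q 0 = c) ->
  abs_summable P (walk_weight h) -> abs_summable Q (walk_weight h) ->
  set_weight h [set w | [/\ size w = n.+1, P (take k.+1 w) & Q (drop k w)]] =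
  set_weight h P * set_weight h Q.
Proof.
move=> kn Pk Qk Ps Qs; rewrite /set_weight -sum_over_prod//.
have glue p q : P p -> Q q ->
    take k.+1 (p ++ behead q) = p /\ drop k (p ++ behead q) = q.
  by move=> /Pk[pk pc] /Qk[qm qc]; apply: take_drop_glue pk qm pc qc.
have size_glue p q : P p -> Q q -> size (p ++ behead q) = n.+1.
  by move=> /Pk[pk _] /Qk[qm _]; rewrite size_cat size_behead pk qm/= addSn subnKC.
apply/esym; apply: (@sum_over_reindex _ _ _ _ _ _ _
  (fun pq => pq.1 ++ behead pq.2) (fun w => (take k.+1 w, drop k w))).
- by move=> [p q] [/= Pp Qq]; have [-> ->] := glue _ _ Pp Qq; split=> //; apply: size_glue.
- by move=> w [].
- by move=> [p q] [/= Pp Qq]; have [-> ->] := glue _ _ Pp Qq.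
- by move=> w _; exact: glue_take_drop.
- move=> [p q] [/= Pp Qq]; rewrite (walk_weight_split h (size_glue _ _ Pp Qq) kn).
  by have [-> ->] := glue _ _ Pp Qq.
- exact: abs_summable_prod.
Qed.

Lemma first_hitP s c B n w : size w = n.+1 -> hitting s c B n w <->
  exists2 k, (k < n.+1)%N & [/\ size w = n.+1, first_hit s c k (take k.+1 w) &
    walks c B (n - k) (drop k w)].
Proof.
move=> wn; split.
  move=> [[ww w0] wB [i0 /andP[si0 i0n] wi0]].
  (* The cutting time is the least visit to [c] from time [s] on. *)
  have ex : exists i, (s <= i <= n)%N && (vtx w i == c).
    by exists i0; rewrite si0 i0n wi0/=.
  case: (ex_minnP ex) => k /andP[/andP[sk kn] /eqP wk] kmin.
  exists k => //; have [wt wd] := (is_walk_split wn kn).1 ww.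
  split=> //; split=> //.
  - by split=> //; rewrite vtx_take.
  - by rewrite vtx_take.
  - move=> i /andP[si ik]; rewrite vtx_take ?(ltnW ik) => [wi|//].
    suff : (k <= i)%N by rewrite leqNgt ik.
    by apply: kmin; rewrite si wi eqxx andbT/= (leq_trans (ltnW ik)).
  - by rewrite vtx_drop addn0.
  - by rewrite vtx_drop subnKC.
move=> [k kn [_ [[wt w0] sk wk _] [wd _ wB]]].
rewrite !vtx_take// in w0 wk; rewrite vtx_drop subnKC// in wB.
split=> //; first by split=> //; apply/(is_walk_split wn kn).
by exists k => //; rewrite sk.
Qed.

Lemma first_hit_unique s c w j k : first_hit s c j (take j.+1 w) ->
  first_hit s c k (take k.+1 w) -> j = k.
Proof.
have first_hit_le i l : first_hit s c i (take i.+1 w) ->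
    first_hit s c l (take l.+1 w) -> (l <= i)%N.
  move=> [_ si wi _] [_ _ _ lmin]; rewrite leqNgt; apply/negP => il.
  by rewrite !vtx_take ?(ltnW il)// in wi lmin; apply: (lmin i); rewrite ?si ?vtx_take ?(ltnW il).
by move=> wj wk; apply/eqP; rewrite eqn_leq !first_hit_le.
Qed.

(** The walks are partitioned by their first hitting time [k], and each class factors by
    [sum_over_glue]. *)
Lemma set_weight_hitting h s c B n : light h ->
  (forall m, abs_summable (walks c B m) (walk_weight h)) ->
  set_weight h (hitting s c B n) =
  conv (fun k => set_weight h (first_hit s c k))
       (fun m => set_weight h (walks c B m)) n.
Proof.
move=> hl cs; pose X k : set (seq vertex) := [set w | (k < n.+1)%N /\
  [/\ size w = n.+1, first_hit s c k (take k.+1 w) & walks c B (n - k) (drop k w)]].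
have XE w : hitting s c B n w <-> exists2 k, (k < n.+1)%N & X k w.
  split=> [Hw|[k kn [_ Xw]]].
    have wn : size w = n.+1 by case: Hw => -[[]].
    by have [k kn Xw] := (first_hitP s c B wn).1 Hw; exists k.
  by have [wn _ _] := Xw; apply/(first_hitP s c B wn); exists k.
rewrite /set_weight (eq_sum_over _ XE) sum_over_bigcup.
- apply: eq_bigr => -[k /= kn] _.
  rewrite -[RHS](@sum_over_glue h n k _ _ c)//.
  + by apply: eq_sum_over => w; split=> [[]|].
  + by move=> p [[[]]].
  + by move=> q [[]].
  + by apply: abs_summable_sub (hl k) => w [].
- by move=> w j k [_ [_ wj _]] [_ [_ wk _]]; exact: first_hit_unique wj wk.
- by apply: abs_summable_sub (hl n) => w /XE[].
Qed.

(** * Transport of walks along a weight-preserving bijection of the vertices *)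

Section Transport.
Context (h : weight R) (f g : vertex -> vertex).
Hypotheses (fK : cancel f g) (gK : cancel g f).
Hypothesis fh : forall a b, a != b -> pair_weight h (f a) (f b) = pair_weight h a b.

(** Stated for any map with a left inverse, so that it serves both [f] and [g]; injectivity keeps
    consecutive vertices distinct. *)
Lemma walks_map (f1 f2 : vertex -> vertex) a B n w : cancel f1 f2 ->
  walks a B n w -> walks (f1 a) [set b | B (f2 b)] n (map f1 w).
Proof.
move=> f12 [[wn ww] w0 wB].
have vm i : (i <= n)%N -> vtx (map f1 w) i = f1 (vtx w i).
  by move=> ik; rewrite vtx_map ?wn.
split; first split.
- by rewrite size_map.
- by move=> i ik; rewrite !vm ?(ltnW ik)// => /(can_inj f12); exact: ww.
- by rewrite vm// w0.
- by rewrite /= vm// f12.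
Qed.

Lemma walk_weight_map a B n w : walks a B n w ->
  walk_weight h (map f w) = walk_weight h w.
Proof.
move=> [[wn ww] _ _]; rewrite !walk_weightE size_map wn.
apply: eq_big_nat => i /andP[_ iw].
have [iw0 iw1] : (i < size w)%N /\ (i.+1 < size w)%N by rewrite wn !ltnS (ltnW iw).
by rewrite !vtx_map// fh//; apply/eqP; exact: ww.
Qed.

Lemma map_walks a B n w : walks (f a) [set b | B (g b)] n w ->
  walks a B n (map g w).
Proof.
move=> /(walks_map gK); rewrite fK; congr (walks _ _ _ _).
by apply/seteqP; split=> b /=; rewrite fK.
Qed.

Lemma abs_summable_map a B n : abs_summable (walks a B n) (walk_weight h) ->
  abs_summable (walks (f a) [set b | B (g b)] n) (walk_weight h).
Proof.
apply: (@abs_summable_reindex _ _ _ _ _ _ _ (map f) (map g)).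
- by move=> w; exact: map_walks.
- by move=> w _; exact: mapK.
- by move=> w; exact: walk_weight_map.
Qed.

Lemma set_weight_map a B n : abs_summable (walks a B n) (walk_weight h) ->
  set_weight h (walks a B n) = set_weight h (walks (f a) [set b | B (g b)] n).
Proof.
apply: (@sum_over_reindex _ _ _ _ _ _ _ (map f) (map g)).
- by move=> w; exact: walks_map.
- by move=> w; exact: map_walks.
- by move=> w _; exact: mapK.
- by move=> w _; exact: mapK.
- by move=> w; exact: walk_weight_map.
Qed.

End Transport.

Lemma walks_rev a b n w : walks a [set b] n w -> walks b [set a] n (rev w).
Proof.
move=> [[wn ww] w0 wb].
have vr i : (i <= n)%N -> vtx (rev w) i = vtx w (n - i).
  by move=> ik; rewrite /vtx nth_rev ?wn// subSS.
split; first split.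
- by rewrite size_rev.
- move=> i ik; rewrite !vr ?(ltnW ik)// => E; apply: (ww (n - i.+1)%N); last first.
    by rewrite -E -subSn// subSS.
  by rewrite ltn_subrL (leq_ltn_trans _ ik).
- by rewrite vr// subn0.
- by rewrite /= vr// subnn.
Qed.

(** Edges are unordered, so reversal merely permutes the factors. *)
Lemma walk_weight_rev h w : walk_weight h (rev w) = walk_weight h w.
Proof.
rewrite !walk_weightE size_rev big_nat_rev add0n; case wn : (size w) => [|n].
  by rewrite !big_geq.
apply: eq_big_nat => i /andP[_ /= iw].
have [iw0 iw1] : (n - i.+1 < size w)%N /\ ((n - i.+1).+1 < size w)%N.
  by rewrite wn !ltnS -subSn// subSS !leq_subr.
have e0 : (n.+1 - (n - i.+1).+1 = i.+1)%N by rewrite subSS subKn.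
have e1 : (n.+1 - (n - i.+1).+2 = i)%N.
  by rewrite -subSn// !subSS subKn// ltnW.
by rewrite pair_weightC /vtx !nth_rev// wn e0 e1.
Qed.

Lemma set_weight_rev h a b n : abs_summable (walks a [set b] n) (walk_weight h) ->
  set_weight h (walks a [set b] n) = set_weight h (walks b [set a] n).
Proof.
apply: (@sum_over_reindex _ _ _ _ _ _ _ rev rev).
- by move=> w; exact: walks_rev.
- by move=> w; exact: walks_rev.
- by move=> w _; exact: revK.
- by move=> w _; exact: revK.
- by move=> w _; exact: walk_weight_rev.
Qed.

(** * Convolution identities for a transitive light weight *)

Section TransitiveWeight.
Context (h : weight R) (v : vertex).
Hypotheses (hl : light h) (hv : transitive_at v h).

Lemma abs_summable_one B m : abs_summable (walks one B m) (walk_weight h).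
Proof. by apply: abs_summable_sub (hl m) => w []. Qed.

(** Lightness concerns walks from 1; the bijection sending 1 to [v] carries it over to walks from
    [v]. *)
Lemma abs_summable_v B m : abs_summable (walks v B m) (walk_weight h).
Proof.
have [f [[g fK gK] f1 fh]] := hv.
have := abs_summable_map fK gK fh (abs_summable_one [set: vertex] m).
by rewrite f1; apply: abs_summable_sub => w [].
Qed.

Lemma set_weight_walks_v m :
  set_weight h (walks v [set: vertex] m) = D_ h m.
Proof.
have [f [[g fK gK] f1 fh]] := hv.
have := set_weight_map fK gK fh (abs_summable_one [set: vertex] m); rewrite f1.
rewrite /D_ [W m](_ : _ = walks one [set: vertex] m) => [->//|].
by apply/seteqP; split=> w; [case|case].
Qed.

Lemma set_weight_closed_v m : set_weight h (walks v [set v] m) = B_ h m.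
Proof.
have [f [[g fK gK] f1 fh]] := hv.
have := set_weight_map fK gK fh (abs_summable_one [set one] m); rewrite f1.
have -> : [set b | [set one]%classic (g b)] = [set v]%classic.
  by apply/seteqP; split=> b /=; [move=> gb; rewrite -f1 -gb gK|move=> ->; rewrite -f1 fK].
move=> <-; apply: eq_sum_over => w; split=> [[]|[[]]]; by [].
Qed.

Lemma Cv_first_hit : Cv_ h v = fun k => set_weight h (first_hit 0 v k).
Proof.
apply/funext => k; apply: eq_sum_over => w; split=> [[wW wv wf]|[wW _ wv wf]].
  by split=> // i /= ik; exact: wf.
by split=> // i ik; exact: wf.
Qed.

Lemma C_first_hit : C_ h = fun k => set_weight h (first_hit 1 one k).
Proof.
apply/funext => k; apply: eq_sum_over => w; split=> [[k1 [wW w1] wf]|[wW k1 w1 wf]];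
  by split.
Qed.

Lemma A_conv : A_ h v = conv (Cv_ h v) (D_ h).
Proof.
apply/funext => n; rewrite Cv_first_hit.
rewrite -[D_ h](_ : (fun m => set_weight h (walks v [set: vertex] m)) = _); last first.
  by apply/funext => m; exact: set_weight_walks_v.
rewrite -set_weight_hitting//; last exact: abs_summable_v.
by apply: eq_sum_over => w; split=> [[wW [i ii wi]]|[wW _ [i ii wi]]];
  [split=> //; exists i|split=> //; exists i].
Qed.

Lemma B_conv n : B_ h n = delta n + conv (C_ h) (B_ h) n.
Proof.
have -> : B_ h = fun m => set_weight h (walks one [set one] m).
  by apply/funext => m; apply: eq_sum_over => w; split=> [[[]]|[]].
rewrite C_first_hit -set_weight_hitting//; last exact: abs_summable_one.
(* In length 0 there is no time at which to return, so the convolution vanishes and the trivial walk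
   of weight 1 supplies [delta]. In positive length the endpoint itself is a return. *)
case: n => [|n].
  rewrite [hitting _ _ _ _](_ : _ = set0); last first.
    by apply/seteqP; split=> w // [_ _ [i /andP[i1]]]; rewrite leqNgt i1.
  rewrite /set_weight sum_over_set0 addr0.
  rewrite [walks _ _ _](_ : _ = [set [:: one]]%classic) ?sum_over_set1.
    by rewrite /walk_weight big_ord0.
  apply/seteqP; split=> w /=; last by move=> ->.
  by move=> [[+ _] + _]; case: w => [|a []]// _ /= <-.
rewrite [delta _]/(0) add0r; apply: eq_sum_over => w; split=> [[ww w0 w1]|[[ww w0] w1 _]].
  by split=> //; exists n.+1; rewrite ?leqnn.
by [].
Qed.

Lemma Bv_conv n : B_ h n = Bv_ h v n + conv (Cv_ h v) (conv (Cv_ h v) (B_ h)) n.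
Proof.
(* Reversed, a walk from [v] to 1 ends at [v] and so certainly hits it; after the first hit there
   remains a closed walk at [v], counted by [B_ h]. *)
have -> : conv (Cv_ h v) (B_ h) = fun m => set_weight h (walks v [set one] m).
  apply/funext => m; rewrite set_weight_rev; last exact: abs_summable_v.
  rewrite Cv_first_hit.
  rewrite -[B_ h](_ : (fun m => set_weight h (walks v [set v] m)) = _); last first.
    by apply/funext => j; exact: set_weight_closed_v.
  rewrite -set_weight_hitting//; last exact: abs_summable_v.
  apply: eq_sum_over => w; split=> [[[ww w1] wv _]//|[ww w1 wv]].
  by split=> //; exists m; rewrite ?leqnn.
rewrite Cv_first_hit -set_weight_hitting//; last exact: abs_summable_v.
rewrite -[RHS]sum_overU.
- apply: eq_sum_over => w; split=> [[wW w1]|[[]//|[wW w1 _]//]].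
  have [[i ii wi]|nv] := pselect (exists2 i, (0 <= i <= n)%N & vtx w i = v).
    by right; split=> //; exists i.
  by left; split=> // i ii wi; apply: nv; exists i.
- by move=> w [_ wf] [_ _ [i /andP[_ ii] wi]]; exact: wf wi.
- by apply: abs_summable_sub (hl n) => w [[[]]|[]].
Qed.

End TransitiveWeight.

End Walks.

(** * Evaluation of the identities at 1 *)

Theorem theorem7 (R : realType) (v : vertex) (h : weight R) :
  v <> one ->
  transitive_at v h ->
  light h ->
  V h v ->
  exists_at1 (D_ h) ->
  exists_at1 (Cv_ h v) ->
  exists_at1 (C_ h) ->
  exists_at1 (Bv_ h v) ->
  exists_at1 (B_ h) ->
  exists_at1 (A_ h v) ->
  at1 (B_ h) <> 0 /\
  mul_sqrt (at1 (D_ h)) (1 - at1 (Bv_ h v) / at1 (B_ h)) (at1 (A_ h v)).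
Proof.
move=> _ hv hl _ /cvg_psum sD /cvg_psum sCv /cvg_psum sC /cvg_psum sBv /cvg_psum sB.
move=> /cvg_psum sA.
have hA : at1 (A_ h v) = at1 (Cv_ h v) * at1 (D_ h).
  by apply: psum_conv sCv sD; rewrite -A_conv.
have hB : at1 (B_ h) - 1 = at1 (C_ h) * at1 (B_ h).
  apply: (psum_conv _ sC sB).
  (* The convergence of the product, which [psum_conv] requires, is read off from [B_conv]. *)
  have -> : psum (conv (C_ h) (B_ h)) = fun n => psum (B_ h) n - psum delta n.
    apply/funext => n; rewrite /psum -sumrB; apply: eq_bigr => i _.
    by rewrite [in RHS](B_conv hl) addrAC subrr add0r.
  exact: (cvgB sB psum_delta).
have hBv : at1 (B_ h) - at1 (Bv_ h v) = at1 (Cv_ h v) * at1 (Cv_ h v) * at1 (B_ h).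
  apply: (psum_conv3 _ sCv sCv sB).
  have -> : psum (conv (Cv_ h v) (conv (Cv_ h v) (B_ h))) =
      fun n => psum (B_ h) n - psum (Bv_ h v) n.
    apply/funext => n; rewrite /psum -sumrB; apply: eq_bigr => i _.
    by rewrite [in RHS](Bv_conv hl hv) addrAC subrr add0r.
  exact: (cvgB sB sBv).
have B0 : at1 (B_ h) != 0.
  (* If B(1) were 0, [hB] would read -1 = 0. *)
  apply/eqP => B0; move: hB; rewrite B0 mulr0 sub0r => /eqP.
  by rewrite oppr_eq0 oner_eq0.
split; first exact/eqP.
exists (at1 (Cv_ h v)); last by rewrite hA mulrC.
by rewrite /= expr2 -[LHS](mulfK B0) -hBv mulrBl divff.
Qed.
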